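(* Let $G$ and $H$ be reflexive graphs. Then $G\searrow^{d}H$ if and only if $\Delta_{\mathscr G}(G)\searrow\!\!\searrow\Delta_{\mathscr G}(H)$.
   Context: Graphs are finite, undirected, without parallel edges; loops are allowed; a graph is reflexive if every vertex is looped. $N_G(x)=\{y: y\sim x\}$. A vertex $x$ of $G$ is dismantlable if there is a vertex $a\neq x$ with $N_G(x)\subset N_G(a)$. $G\searrow^{d}H$ means: $H$ is a subgraph of $G$, namely the one induced by $V(H)$, and one can write $V(G)\setminus V(H)=\{x_1,\dots,x_k\}$ ($k\ge0$, distinct) so that each $x_i$ is dismantlable in the subgraph of $G$ induced by $V(H)\cup\{x_i,\dots,x_k\}$. $\Delta_{\mathscr G}(G)$ is the clique complex of $G$: the simplicial complex whose simplices are the nonempty sets of pairwise adjacent vertices of $G$. Simplicial complexes are finite. A simplicial complex $K$ is a simplicial cone $aL$ if there are a (possibly empty) subcomplex $L$ and a vertex $a$ not in $L$ such that the simplices of $K$ are exactly $\{a\}$, the $\sigma\in L$ and the $\{a\}\cup\sigma$ with $\sigma\in L$. For a vertex $x$ of $K$, $\mathrm{lk}_K(x)=\{\sigma\in K: x\notin\sigma,\ \{x\}\cup\sigma\in K\}$ and $K-x=\{\sigma\in K: x\notin\sigma\}$. The vertex $x$ is dominated by $a$ (dismantlable) in $K$ if $\mathrm{lk}_K(x)$ is a simplicial cone $aK'$ for some subcomplex $K'$. The deletion $K\searrow\!\!\searrow K-x$ of a dismantlable vertex is an elementary strong collapse, and $K\searrow\!\!\searrow L$ (strong collapse) means that $L$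 is obtained from $K$ by a finite (possibly empty) succession of elementary strong collapses. *)

(* Defs.v *)
From HB Require Import structures.
From mathcomp Require Import all_boot.
Set Implicit Arguments.
Unset Strict Implicit.
Unset Printing Implicit Defensive.

(** All graphs and complexes are built on vertices taken from an ambient finite
    type [T], so that a graph and its subgraphs, or a complex and its
    subcomplexes, can be compared. *)

Record graph (T : finType) := Graph {
  vset : {set T};
  adj : rel T;
  adj_sym : symmetric adj;
  adj_vset : forall x y, adj x y -> (x \in vset) && (y \in vset)
}.

Section Graphs.
Variable T : finType.
Implicit Types (G H : graph T) (A : {set T}) (x a : T).

Definition reflexive_graph G : Prop := forall x, x \in vset G -> adj G x x.

Definition nbhd G x : {set T} := [set y | adj G x y].

Definition induced_adj G A : rel T :=
  [rel x y | [&& x \in A, y \in A & adj G x y]].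

Lemma induced_adj_sym G A : symmetric (induced_adj G A).
Proof. by move=> x y; rewrite /induced_adj /= (adj_sym G) andbCA. Qed.

Lemma induced_adj_vset G A x y :
  induced_adj G A x y -> (x \in vset G :&: A) && (y \in vset G :&: A).
Proof.
by case/and3P=> xA yA /adj_vset/andP[xG yG]; rewrite !inE xA yA xG yG.
Qed.

Definition induced G A : graph T :=
  Graph (@induced_adj_sym G A) (@induced_adj_vset G A).

Definition dismantlable_in_graph G x : Prop :=
  x \in vset G /\
  exists a, [/\ a \in vset G, a != x & nbhd G x \subset nbhd G a].

Definition induced_subgraph H G : Prop :=
  vset H \subset vset G /\ {in vset H &, adj H =2 adj G}.

(** In a decomposition [s = s1 ++ x :: s2], the vertex [x] is some x_i and
    [x :: s2] lists x_i, ..., x_k. *)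
Definition dismantles_to G H : Prop :=
  induced_subgraph H G /\
  exists s : seq T,
    [/\ uniq s, [set x in s] = vset G :\: vset H &
        forall s1 x s2, s = s1 ++ x :: s2 ->
          dismantlable_in_graph (induced G (vset H :|: [set y in x :: s2])) x].

End Graphs.

(** Simplices are nonempty; the complex without simplices is allowed. *)
Definition is_scomplex (T : finType) (K : {set {set T}}) : bool :=
  (set0 \notin K) &&
  [forall s : {set T} in K, forall t : {set T},
     (t != set0) && (t \subset s) ==> (t \in K)].

Record scomplex (T : finType) := SComplex {
  simplices :> {set {set T}};
  scomplexP : is_scomplex simplices
}.

HB.instance Definition _ (T : finType) := [isSub for @simplices T].

Section Complexes.
Variable T : finType.
Implicit Types (G : graph T) (K L : scomplex T) (x a : T) (s t : {set T}).

Lemma is_scomplexP (K : {set {set T}}) :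
  reflect (set0 \notin K /\
           forall s t, s \in K -> t != set0 -> t \subset s -> t \in K)
          (is_scomplex K).
Proof.
apply: (iffP andP) => -[K0 Kd]; split=> //.
  move=> s t sK t0 ts; move/forall_inP/(_ s sK)/forallP/(_ t): Kd.
  by rewrite t0 ts.
apply/forall_inP=> s sK; apply/forallP=> t; apply/implyP=> /andP[t0 ts].
exact: Kd sK t0 ts.
Qed.

Definition vertex K x : bool := [set x] \in K.

Definition link_set K x : {set {set T}} :=
  [set s in K | (x \notin s) && (x |: s \in K)].

Lemma link_set_scomplex K x : is_scomplex (link_set K x).
Proof.
have /is_scomplexP[K0 Kd] := scomplexP K.
apply/is_scomplexP; split=> [|s t]; first by rewrite !inE (negPf K0).
rewrite !inE => /and3P[sK xs xsK] t0 ts; apply/and3P; split.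
- exact: Kd sK t0 ts.
- by apply: contra xs; apply: (subsetP ts).
- apply: Kd xsK _ (setUS _ ts).
  by apply/set0Pn; exists x; rewrite !inE eqxx.
Qed.

Definition link K x : scomplex T := SComplex (link_set_scomplex K x).

Definition deletion_set K x : {set {set T}} := [set s in K | x \notin s].

Lemma deletion_set_scomplex K x : is_scomplex (deletion_set K x).
Proof.
have /is_scomplexP[K0 Kd] := scomplexP K.
apply/is_scomplexP; split=> [|s t]; first by rewrite !inE (negPf K0).
rewrite !inE => /andP[sK xs] t0 ts; apply/andP; split.
  exact: Kd sK t0 ts.
by apply: contra xs; apply: (subsetP ts).
Qed.

Definition deletion K x : scomplex T := SComplex (deletion_set_scomplex K x).

(** [is_cone a L K] : [K] is the simplicial cone [aL]; that [L] is a subcomplex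
    of [K] follows from the description of the simplices. *)
Definition is_cone a L K : Prop :=
  ~~ vertex L a /\
  forall s, s \in K <->
    [\/ s = [set a], s \in L | exists2 t, t \in L & s = a |: t].

Definition dominated_by K x a : Prop :=
  vertex K x /\ exists L, is_cone a L (link K x).

Definition dismantlable_in_complex K x : Prop :=
  exists a, dominated_by K x a.

Inductive strong_collapse : scomplex T -> scomplex T -> Prop :=
| strong_collapse_refl K : strong_collapse K K
| strong_collapse_step K x L :
    dismantlable_in_complex K x -> strong_collapse (deletion K x) L ->
    strong_collapse K L.

Definition clique_set G : {set {set T}} :=
  [set s : {set T} | [&& s != set0, s \subset vset G &
     [forall x in s, forall y in s, (x != y) ==> adj G x y]]].

Lemma clique_set_scomplex G : is_scomplex (clique_set G).
Proof.
apply/is_scomplexP; split=> [|s t]; first by rewrite inE eqxx.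
rewrite !inE => /and3P[s0 sG sC] t0 ts; apply/and3P; split=> //.
  exact: subset_trans ts sG.
apply/forall_inP=> x /(subsetP ts) xs; apply/forall_inP=> y /(subsetP ts) ys.
by move/forall_inP/(_ x xs)/forall_inP/(_ y ys): sC.
Qed.

Definition clique_complex G : scomplex T := SComplex (clique_set_scomplex G).

End Complexes.

(* Main.v *)
Require Import Defs.
From HB Require Import structures.
From mathcomp Require Import all_boot.
Set Implicit Arguments.
Unset Strict Implicit.
Unset Printing Implicit Defensive.

(** Deleting one vertex means the same thing on both sides.  In a reflexive
    graph [G], the link of [x] in the clique complex consists of the cliques of
    neighbours of [x] other than [x], and it is a cone of apex [a] exactly when
    [a] is a neighbour of [x], [a != x], that is adjacent to every neighbour of
    [x]; by reflexivity this says that the neighbourhood of [x] is contained in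
    that of [a] ([dominated_clique_complexP]).  Moreover the cliques of [G]
    avoiding [x] are the cliques of [G - x] ([deletion_clique_complex]).

    So a sequence of elementary strong collapses that starts from a clique
    complex only meets clique complexes, and it is a sequence of dismantlings
    read through [clique_complex].  It ends correctly because a reflexive graph
    can be recovered from its clique complex: its vertices and edges are the
    simplices with one and two elements ([clique_complex_eqP]).  Both
    directions are then inductions that peel off the first deletion, for which
    [dismantles_toP] reads an enumeration of the deleted vertices as a first
    step followed by a dismantling of the rest. *)

Section Dismantling.
Variable T : finType.
Implicit Types (G H : graph T) (A s : {set T}) (x a : T).

Definition same_graph G H : Prop := vset G = vset H /\ adj G =2 adj H.

Definition delete_vertex G x : graph T := induced G [set~ x].

Lemma vset_delete G x : vset (delete_vertex G x) = vset G :\ x.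
Proof. by rewrite setDE. Qed.

Lemma adj_delete G x y z :
  adj (delete_vertex G x) y z = [&& y != x, z != x & adj G y z].
Proof. by rewrite /= /induced_adj /= !in_setC1. Qed.

Lemma reflexive_delete G x :
  reflexive_graph G -> reflexive_graph (delete_vertex G x).
Proof.
move=> rG y; rewrite vset_delete !inE => /andP[yx yG].
by rewrite adj_delete yx rG.
Qed.

(** * Dismantling a graph one vertex at a time *)

(** Graphs carry their adjacency as a function, so two induced subgraphs with
    the same vertices and edges need not be equal terms; this description
    depends only on the vertices and edges, and moves dismantlability between
    them. *)
Lemma dismantlable_inducedP G A x : A \subset vset G ->
  dismantlable_in_graph (induced G A) x <->
  x \in A /\
  exists a, [/\ a \in A, a != x & {in A, forall y, adj G x y -> adj G a y}].
Proof.
move=> /setIidPr AG; rewrite /dismantlable_in_graph /= AG.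
split=> -[xA [a [aA ax sub]]]; split=> //; exists a; split=> //.
  move=> y yA xy; have /(subsetP sub) : y \in nbhd (induced G A) x.
    by rewrite inE /= /induced_adj /= xA yA.
  by rewrite inE /= /induced_adj /= => /and3P[].
apply/subsetP=> y; rewrite !inE /= /induced_adj /= => /and3P[_ yA xy].
by rewrite aA yA sub.
Qed.

Lemma dismantlable_induced_vset G x :
  dismantlable_in_graph (induced G (vset G)) x <-> dismantlable_in_graph G x.
Proof.
apply: (iff_trans (dismantlable_inducedP _ (subxx _))).
split=> -[xG [a [aG ax sub]]]; split=> //; exists a; split=> //.
  apply/subsetP=> y; rewrite !inE => xy; apply: sub => //.
  by case/andP: (adj_vset xy).
by move=> y yG xy; have := subsetP sub y; rewrite !inE; apply.
Qed.

Lemma dismantlable_induced_delete G A x y :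
  A \subset vset G :\ x ->
  dismantlable_in_graph (induced (delete_vertex G x) A) y <->
  dismantlable_in_graph (induced G A) y.
Proof.
move=> AGx.
have [AG xA] : A \subset vset G /\ x \notin A.
  by move: AGx; rewrite subsetD1 => /andP.
have nx := memPn xA.
have AGx' : A \subset vset (delete_vertex G x) by rewrite vset_delete.
apply: iff_trans (dismantlable_inducedP _ AGx') _.
apply: iff_trans (iff_sym (dismantlable_inducedP _ AG)).
split=> -[yA [a [aA ay sub]]]; split=> //; exists a; split=> // z zA.
  by have := sub z zA; rewrite !adj_delete !nx.
by rewrite !adj_delete !nx //; apply: sub.
Qed.

Lemma dismantles_to_refl G H : same_graph G H -> dismantles_to G H.
Proof.
case=> eV eE; split; first by split=> [|x y _ _]; rewrite ?eV ?eE.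
exists [::]; split=> // [|s1 x s2].
  by rewrite eV setDv; apply/setP=> x; rewrite !inE.
by case: s1.
Qed.

Lemma dismantles_to_step G H x :
  dismantlable_in_graph G x -> dismantles_to (delete_vertex G x) H ->
  dismantles_to G H.
Proof.
move=> dx [[sub eqE] [s [us es hs]]]; have [xG _] := dx.
rewrite vset_delete in sub es.
have [HG xH] : vset H \subset vset G /\ x \notin vset H.
  by move: sub; rewrite subsetD1 => /andP.
have xs : x \notin s.
  by have := in_setD (vset G :\ x) (vset H) x; rewrite -es !inE eqxx andbF => ->.
split.
  split=> // y z yH zH; rewrite eqE // adj_delete.
  by rewrite !(memPn xH).
have memH y : (y \in s) = [&& y \notin vset H, y != x & y \in vset G].
  by move/setP/(_ y): es; rewrite !inE.
exists (x :: s); split=> [|| [|x' s1] y s2 /=].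
- by rewrite /= xs.
- apply/setP=> y; rewrite !inE memH.
  by case: eqVneq => // ->; rewrite xH xG.
- case=> <- <-.
  suff -> : vset H :|: [set y0 in x :: s] = vset G by apply/dismantlable_induced_vset.
  apply/setP=> z; rewrite !inE memH.
  case: eqVneq => [->|_] /=; first by rewrite xG orbT.
  by case: (boolP (z \in vset H)) => [/(subsetP HG) ->|].
- case=> _ e; apply/dismantlable_induced_delete; last exact: hs e.
  rewrite subUset sub; apply/subsetP=> z; rewrite inE => zs.
  have : z \in s by rewrite e mem_cat zs orbT.
  by rewrite memH !inE => /and3P[_ -> ->].
Qed.

(** The conditions on the tail of an enumeration of the deleted vertices only
    involve the vertices still present, so they are the conditions for the
    graph without the first vertex. *)
Lemma dismantles_toP G H :
  dismantles_to G H <->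
  same_graph G H \/
  exists2 x, dismantlable_in_graph G x & dismantles_to (delete_vertex G x) H.
Proof.
split; last by case=> [/dismantles_to_refl|[x /dismantles_to_step h /h]].
case=> -[HG eqE] [[|x s] [us es hs]].
  have GH : vset G = vset H.
    apply/eqP; rewrite eqEsubset HG andbT -setD_eq0 -es.
    by apply/eqP/setP=> x; rewrite !inE.
  left; split=> // x y.
  (* Both adjacencies vanish outside the common vertex set. *)
  case: (boolP ((x \in vset H) && (y \in vset H))) => [/andP[xH yH]|nH].
    by rewrite eqE.
  apply/idP/idP=> /adj_vset; last by rewrite (negPf nH).
  by rewrite GH (negPf nH).
have memH y : (y \in x :: s) = (y \notin vset H) && (y \in vset G).
  by move/setP/(_ y): es; rewrite !inE.
have /andP[xH xG] : (x \notin vset H) && (x \in vset G).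
  by rewrite -memH mem_head.
case/andP: us => xs us.
have sGx : vset H \subset vset G :\ x by rewrite subsetD1 HG.
right; exists x.
  apply/dismantlable_induced_vset.
  suff <- : vset H :|: [set y in x :: s] = vset G by exact: (hs [::]).
  apply/setP=> z; rewrite in_setU inE memH.
  by case: (boolP (z \in vset H)) => [/(subsetP HG) ->|].
split.
  split; rewrite ?vset_delete // => y z yH zH; rewrite eqE // adj_delete.
  by rewrite !(memPn xH).
exists s; split=> // [|s1 y s2 e].
  apply/setP=> z; rewrite vset_delete; have := memH z; rewrite !inE.
  case: eqVneq => [->|_] /=; last by [].
  by rewrite (negPf xs) andbF.
apply/dismantlable_induced_delete; last by apply: (hs (x :: s1)); rewrite e.
rewrite subUset sGx; apply/subsetP=> z; rewrite inE => zs.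
have zs' : z \in s by rewrite e mem_cat zs orbT.
have := memH z; rewrite inE zs' orbT => /esym/andP[_ zG].
by rewrite !inE zG andbT; apply: contraNneq xs => <-.
Qed.

(** * Clique complexes of reflexive graphs *)

Lemma clique_complexP G s : reflexive_graph G ->
  reflect (s != set0 /\ {in s &, forall x y, adj G x y})
          (s \in simplices (clique_complex G)).
Proof.
move=> rG; rewrite inE; apply: (iffP and3P) => [[s0 sG /forall_inP cl]|[s0 cl]].
  split=> // x y xs ys; have [->|xy] := eqVneq x y.
    by rewrite rG // (subsetP sG).
  by move/forall_inP/(_ y ys): (cl x xs); rewrite xy.
split=> //.
  by apply/subsetP=> x xs; case/andP: (adj_vset (cl x x xs xs)).
by do 2![apply/forall_inP=> ? ?]; rewrite cl ?implybT.
Qed.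

Lemma edge_clique_complex G x y : reflexive_graph G ->
  ([set x; y] \in simplices (clique_complex G)) = adj G x y.
Proof.
move=> rG; apply/(clique_complexP _ rG)/idP => [[_ ->]|xy].
- by [].
- by rewrite !inE eqxx.
- by rewrite !inE eqxx orbT.
have /andP[xG yG] := adj_vset xy; split.
  by apply/set0Pn; exists x; rewrite !inE eqxx.
by move=> u v; rewrite !inE => /orP[]/eqP-> /orP[]/eqP->; rewrite ?rG // adj_sym.
Qed.

Lemma vertex_clique_complex G x : reflexive_graph G ->
  vertex (clique_complex G) x = (x \in vset G).
Proof.
move=> rG; rewrite /vertex -[[set x]]setUid edge_clique_complex //.
by apply/idP/idP=> [/adj_vset/andP[]|/rG].
Qed.

Lemma clique_complex_eqP G H : reflexive_graph G -> reflexive_graph H ->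
  clique_complex G = clique_complex H <-> same_graph G H.
Proof.
move=> rG rH; split=> [e|[_ eE]].
  split=> [|x y]; last by rewrite -!edge_clique_complex // e.
  by apply/setP=> x; rewrite -!vertex_clique_complex // e.
apply/val_inj/setP=> s /=.
apply/(clique_complexP _ rG)/(clique_complexP _ rH) => -[s0 cl];
  split=> // x y xs ys; first by rewrite -eE cl.
by rewrite eE cl.
Qed.

Lemma deletion_clique_complex G x : reflexive_graph G ->
  deletion (clique_complex G) x = clique_complex (delete_vertex G x).
Proof.
move=> rG; apply/val_inj/setP=> s; rewrite inE.
apply/andP/(clique_complexP _ (reflexive_delete (x := x) rG)).
  case=> /(clique_complexP _ rG)[s0 cl] xs; split=> // y z ys zs.
  by rewrite adj_delete cl // !(memPn xs).
case=> s0 cl; split.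
  apply/(clique_complexP _ rG); split=> // y z ys zs.
  by have := cl y z ys zs; rewrite adj_delete => /and3P[].
by apply/negP=> xs; have := cl x x xs xs; rewrite adj_delete eqxx.
Qed.

Lemma link_clique_complexP G x s : reflexive_graph G ->
  reflect [/\ s != set0, x \notin s & {in x |: s &, forall y z, adj G y z}]
          (s \in simplices (link (clique_complex G) x)).
Proof.
move=> rG; rewrite inE; apply: (iffP and3P).
  by case=> /(clique_complexP _ rG)[s0 _] xs /(clique_complexP _ rG)[_ cl].
case=> s0 xs cl; split=> //; apply/(clique_complexP _ rG); split=> //.
  by move=> y z ys zs; apply: cl; rewrite !inE ?ys ?zs orbT.
by apply/set0Pn; exists x; rewrite !inE eqxx.
Qed.

(** If the link is a cone of apex [a], a neighbour [y] of [x] with [y != x]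
    is a vertex of the link, and coning [y] off yields the edge between [a] and [y].  Conversely,
    if [a] is adjacent to all neighbours of [x], then adding [a] to a clique of
    neighbours of [x] keeps it a clique, so the link is the cone of apex [a]
    over its simplices avoiding [a]. *)
Lemma dominated_clique_complexP G x a : reflexive_graph G ->
  dominated_by (clique_complex G) x a <->
  [/\ x \in vset G, a \in vset G, a != x & nbhd G x \subset nbhd G a].
Proof.
move=> rG; rewrite /dominated_by vertex_clique_complex //; split.
  case=> xG [L [_ coneL]].
  have /(link_clique_complexP _ _ rG)[_ xa cl_a] :
    [set a] \in simplices (link (clique_complex G) x).
    by apply/coneL; constructor 1.
  have ax : a != x by rewrite eq_sym; rewrite inE in xa.
  have adj_ax : adj G a x by apply: cl_a; rewrite !inE eqxx ?orbT.
  have /andP[aG _] := adj_vset adj_ax.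
  split=> //; apply/subsetP=> y; rewrite !inE => xy.
  have [->//|yx] := eqVneq y x; have [->|ya] := eqVneq y a; first exact: rG.
  have /andP[_ yG] := adj_vset xy.
  have /coneL[] : [set y] \in simplices (link (clique_complex G) x).
    apply/(link_clique_complexP _ _ rG); split.
    - by apply/set0Pn; exists y; rewrite inE.
    - by rewrite inE eq_sym.
    - by move=> u v; rewrite !inE => /orP[]/eqP-> /orP[]/eqP->;
        rewrite ?rG // adj_sym.
  - by move=> /set1_inj eya; rewrite eya eqxx in ya.
  - move=> yL; have /(link_clique_complexP _ _ rG)[_ _] :
      a |: [set y] \in simplices (link (clique_complex G) x).
      by apply/coneL; constructor 3; exists [set y].
    by apply; rewrite !inE eqxx ?orbT.
  - move=> [t _ e]; have : a \in [set y] by rewrite e !inE eqxx.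
    by rewrite inE eq_sym (negPf ya).
case=> xG aG ax /subsetP sub.
have nb y : adj G x y -> adj G a y by have := sub y; rewrite !inE.
have adj_ax := nb x (rG x xG).
split=> //; exists (deletion (link (clique_complex G) x) a); split.
  by rewrite /vertex inE set11 andbF.
move=> s; split.
  move=> sK; have [as_|nas] := boolP (a \in s); last first.
    by constructor 2; rewrite inE sK.
  have [e|ne] := eqVneq (s :\ a) set0.
    by constructor 1; rewrite -(setD1K as_) e setU0.
  constructor 3; exists (s :\ a); last by rewrite setD1K.
  rewrite inE setD11 andbT.
  have /is_scomplexP[_ closed] := scomplexP (link (clique_complex G) x).
  by apply: closed sK ne _; apply: subD1set.
case=> [->||[t]].
- apply/(link_clique_complexP _ _ rG); split.
  + by apply/set0Pn; exists a; rewrite inE.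
  + by rewrite inE eq_sym.
  + by move=> u v; rewrite !inE => /orP[]/eqP-> /orP[]/eqP->;
      rewrite ?rG // adj_sym.
- by rewrite inE => /andP[].
rewrite inE => /andP[/(link_clique_complexP _ _ rG)[_ xt cl] _] ->.
apply/(link_clique_complexP _ _ rG); split.
- by apply/set0Pn; exists a; rewrite !inE eqxx.
- by rewrite !inE negb_or eq_sym ax.
have adj_a y : y \in x |: t -> adj G a y.
  by move=> yt; apply/nb/cl => //; rewrite !inE eqxx.
move=> u v; rewrite !(setUCA [set x]) !(in_setU1 _ a).
move=> /predU1P[->|ut] /predU1P[->|vt].
- exact: rG.
- exact: adj_a.
- by rewrite adj_sym adj_a.
- exact: cl.
Qed.

Lemma dismantlable_clique_complexP G x : reflexive_graph G ->
  dismantlable_in_complex (clique_complex G) x <-> dismantlable_in_graph G x.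
Proof.
move=> rG; split.
  by case=> a /(dominated_clique_complexP _ _ rG)[xG aG ax sub];
    split=> //; exists a.
by case=> xG [a [aG ax sub]]; exists a; apply/dominated_clique_complexP.
Qed.

(** * Dismantlings and strong collapses *)

Lemma dismantles_strong_collapse G H :
  reflexive_graph G -> reflexive_graph H ->
  dismantles_to G H -> strong_collapse (clique_complex G) (clique_complex H).
Proof.
have [n] := ubnP #|vset G|; elim: n G => // n IHn G leGn rG rH.
case/dismantles_toP=> [/(clique_complex_eqP rG rH)->|[x dx GxH]].
  exact: strong_collapse_refl.
apply: (strong_collapse_step (x := x)).
  exact/dismantlable_clique_complexP.
rewrite deletion_clique_complex //; apply: IHn => //.
  by case: dx leGn => xG _; rewrite vset_delete (cardsD1 x (vset G)) xG.
exact: reflexive_delete.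
Qed.

Lemma strong_collapse_dismantles G H :
  reflexive_graph G -> reflexive_graph H ->
  strong_collapse (clique_complex G) (clique_complex H) -> dismantles_to G H.
Proof.
move=> rG rH; move eK: (clique_complex G) => K; move eL: (clique_complex H) => L c.
elim: c G rG eK eL => {K L} [K|K x L dx _ IH] G rG eK eL.
  by apply/dismantles_to_refl/clique_complex_eqP; rewrite ?eK.
apply: (dismantles_to_step (x := x)).
  by apply/dismantlable_clique_complexP; rewrite ?eK.
apply: IH eL; first exact: reflexive_delete.
by rewrite -deletion_clique_complex // eK.
Qed.

End Dismantling.

Theorem theorem4p1 (T : finType) (G H : graph T)
  (hG : reflexive_graph G) (hH : reflexive_graph H) :
  dismantles_to G H <->
  strong_collapse (clique_complex G) (clique_complex H).
Proof.
split; first exact: dismantles_strong_collapse.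
exact: strong_collapse_dismantles.
Qed.
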